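(* Let $G=(V,E)$ be a finite simple graph. Then $G$ is prison-free if and only if the following holds: for every inclusion-wise maximal set $F \subseteq V$ such that $G[F]$ is complete multipartite with at least $4$ parts, and for every vertex $v \in V \setminus F$, the neighbourhood $N(v)$ intersects at most one part of $F$.
   Context: The prison is the 5-vertex graph obtained from the complete graph $K_5$ by deleting two edges that share an endpoint (equivalently, the complement of the disjoint union of a path on 3 vertices and two isolated vertices). A graph is prison-free if it contains no induced subgraph isomorphic to the prison. A graph is complete multipartite with parts (classes) $P_1,\dots,P_m$ if its vertex set is the disjoint union $P_1\cup\dots\cup P_m$ and $uv$ is an edge if and only if $u$ and $v$ lie in different parts. $G[F]$ denotes the subgraph induced by $F$, and $N(v)$ the set of neighbours of $v$. *)

(* Defs.v *)
From mathcomp Require Import all_boot.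

Set Implicit Arguments.
Unset Strict Implicit.
Unset Printing Implicit Defensive.

Definition graph_isomorphic (T1 T2 : finType) (e1 : rel T1) (e2 : rel T2) :=
  exists2 f : T1 -> T2, bijective f & forall x y, e2 (f x) (f y) = e1 x y.

Definition induced (T : finType) (e : rel T) (S : {set T}) :
    rel {x : T | x \in S} :=
  fun x y => e (val x) (val y).

(* K_5 without the two edges {0, 1} and {0, 2}, which share the endpoint 0. *)
Definition prison : rel 'I_5 := fun i j =>
  [&& i != j,
      [set i; j] != [set inord 0; inord 1] &
      [set i; j] != [set inord 0; inord 2]].

Definition prison_free (T : finType) (e : rel T) :=
  forall S : {set T}, ~ graph_isomorphic prison (induced e (S := S)).

Definition neighbours (T : finType) (e : rel T) (v : T) : {set T} :=
  [set w | e v w].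

(* G[F] is complete multipartite and P is its set of parts. The parts are
   nonempty, since [partition P F] excludes [set0] from P, so that #|P| is the
   number of parts. *)
Definition multipartite_parts (T : finType) (e : rel T) (F : {set T})
    (P : {set {set T}}) : bool :=
  partition P F &&
  [forall u in F, forall v in F,
     e u v == [exists A in P, exists B in P,
                 [&& A != B, u \in A & v \in B]]].

Definition complete_multipartite_ge (T : finType) (e : rel T) (k : nat)
    (F : {set T}) : bool :=
  [exists P : {set {set T}}, multipartite_parts e F P && (k <= #|P|)].

(* Main.v *)
Require Import Defs.
From mathcomp Require Import all_boot.

Set Implicit Arguments.
Unset Strict Implicit.
Unset Printing Implicit Defensive.

(** A prison is a [K_4] together with a vertex adjacent to exactly two of its
    vertices, and a graph is complete multipartite exactly when non-adjacency is
    transitive.  If [v] has adjacent neighbours [a], [b] in a complete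
    multipartite [F] containing a [K_4], then applying prison-freeness to
    suitable [K_4]'s shows that non-adjacency is still transitive on
    [v |: F], which contradicts maximality.  Conversely, the [K_4] of a prison
    extends to a maximal [F]; the fifth vertex cannot lie in [F], because it
    misses two adjacent vertices, and it meets two parts of [F]. *)

(** * Adjacency in the prison *)

Lemma eq_set2 (T : finType) (i j a b : T) : i != j ->
  ([set i; j] == [set a; b]) = ((i == a) && (j == b)) || ((i == b) && (j == a)).
Proof.
move=> ij; apply/eqP/idP => [E|].
  have: i \in [set a; b] by rewrite -E set21.
  have: j \in [set a; b] by rewrite -E set22.
  have: a \in [set i; j] by rewrite E set21.
  have: b \in [set i; j] by rewrite E set22.
  rewrite !inE => Hb Ha /orP[]/eqP Hj /orP[]/eqP Hi; subst;
    by rewrite ?eqxx ?orbT // ?eqxx in ij *.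
by case/orP => /andP[/eqP-> /eqP->] //; rewrite setUC.
Qed.

(** Stated with comparisons of natural numbers, which compute on concrete ordinals, unlike [inord]
    and equality of sets. *)
Lemma prisonE (i j : 'I_5) :
  prison i j = (i != j) && ~~ ((i == 0 :> nat) && (0 < j < 3)
                            || (j == 0 :> nat) && (0 < i < 3)).
Proof.
rewrite /prison; case: (eqVneq i j) => //= ij.
rewrite !eq_set2 // -!val_eqE /= !inordK //.
by case: i j {ij} => [[|[|[|i]]] ?] [[|[|[|j]]] ?].
Qed.

(** * Elementary forms of prison-freeness and of complete multipartiteness *)

Section Graph.

Variables (T : finType) (e : rel T).
Hypotheses (e_sym : symmetric e) (e_irr : irreflexive e).

Definition is_K4 p q r s : bool :=
  [&& e p q, e p r, e p s, e q r, e q s & e r s].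

(** The forbidden pattern needs no inequalities: its adjacencies and non-adjacencies force five
    distinct vertices. Here [v, p, q, r, s] play the vertices 0 to 4 of [prison]. *)
Definition no_K4_with_two_nbrs :=
  forall v p q r s, is_K4 p q r s -> ~~ e v p -> ~~ e v q -> e v r -> ~~ e v s.

Definition nonadj_trans (F : {set T}) :=
  {in F & F & F, forall y x z, ~~ e x y -> ~~ e y z -> ~~ e x z}.

Lemma edge_neq x y : e x y -> x != y.
Proof. by apply: contraTneq => ->; rewrite e_irr. Qed.

Lemma prison_freeP : prison_free e <-> no_K4_with_two_nbrs.
Proof.
split => [pf v p q r s /and5P[pq pr ps qr /andP[qs rs]] vp vq vr|nk S].
  apply/negP => vs; pose t := [:: v; p; q; r; s].
  have vNp : v != p by apply: contraNneq vq => ->.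
  have vNq : v != q by apply: contraNneq vp => ->; rewrite e_sym.
  have ut : uniq t.
    by rewrite /= !inE !negb_or vNp vNq !edge_neq.
  pose S := [set x in t].
  have tS (i : 'I_5) : nth v t i \in S by rewrite inE mem_nth.
  pose f (i : 'I_5) : {x : T | x \in S} := Sub (nth v t i) (tS i).
  apply: (pf S); exists f.
    apply: inj_card_bij => [i j /(congr1 val)/= /eqP|].
      by rewrite (nth_uniq v (s := t)) // => /eqP/val_inj.
    by rewrite card_sig card_ord cardsE (leq_trans (card_size t)).
  move=> i j; rewrite prisonE /induced /= -val_eqE /=.
  move: vp vq => /negbTE vp /negbTE vq.
  by case: i j => [[|[|[|[|[|i]]]]] //= ?] [[|[|[|[|[|j]]]]] //= ?];
    rewrite ?e_irr ?pq ?pr ?ps ?qr ?qs ?rs ?vp ?vq ?vr ?vs // e_sym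
      ?pq ?pr ?ps ?qr ?qs ?rs ?vp ?vq ?vr ?vs.
case=> f [g fK gK] fE.
(* Each index carries its bound, so that [prisonE] meets concrete ordinals and reduces by
   computation. *)
pose o k (k5 : k < 5) : T := val (f (Ordinal k5)).
have oE i j (i5 : i < 5) (j5 : j < 5) :
    e (o i i5) (o j j5) = prison (Ordinal i5) (Ordinal j5) by rewrite -fE.
have := nk (o 0 isT) (o 1 isT) (o 2 isT) (o 3 isT) (o 4 isT).
by rewrite /is_K4 !oE !prisonE; move/(_ isT isT isT isT).
Qed.

Lemma multipartite_partsE F P : multipartite_parts e F P ->
  {in F &, forall x y, e x y = (pblock P x != pblock P y)}.
Proof.
case/andP=> /and3P[/eqP cP tP _] /forall_inP H x y xF yF.
have/forall_inP/(_ y yF)/eqP -> := H x xF.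
apply/exists_inP/idP => [[A AP] /exists_inP[B BP /and3P[AB xA yB]]|neq].
  by rewrite (def_pblock tP AP xA) (def_pblock tP BP yB).
rewrite -cP in xF yF.
exists (pblock P x); first by rewrite pblock_mem.
by apply/exists_inP; exists (pblock P y);
  rewrite ?pblock_mem // neq !mem_pblock xF yF.
Qed.

(** Representatives of four parts form a [K_4]. Conversely, non-adjacency is an equivalence relation
    on [F], its classes are the parts, and the vertices of a [K_4] lie in four different classes. *)
Lemma complete_multipartite_ge4P F :
  reflect (nonadj_trans F /\
           exists a b c d, [/\ a \in F, b \in F, c \in F, d \in F & is_K4 a b c d])
    (complete_multipartite_ge e 4 F).
Proof.
apply: (iffP existsP) => [[P /andP[mP P4]]|[tr [a [b [c [d [aF bF cF dF K]]]]]]].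
  have eE := multipartite_partsE mP.
  case/andP: mP => /and3P[/eqP cP tP P0] _.
  split=> [y x z yF xF zF|].
    by rewrite !eE // !negbK => /eqP-> /eqP->.
  have /set0Pn[x0 _] : cover P != set0.
    have /card_gt0P[A AP] : 0 < #|P| by apply: leq_trans P4.
    have /set0Pn[x xA] : A != set0 by apply: contraNneq P0 => <-.
    by apply/set0Pn; exists x; apply/bigcupP; exists A.
  (* [x0] only serves as the default of [odflt]; by [hin] the pick succeeds for [i < 4], as parts
     are nonempty. *)
  pose h i := odflt x0 [pick x in nth set0 (enum P) i].
  have hA i : i < 4 -> nth set0 (enum P) i \in P.
    by move=> i4; rewrite -mem_enum mem_nth // -cardE (leq_trans i4).
  have hin i : i < 4 -> h i \in nth set0 (enum P) i.
    move=> i4; rewrite /h; case: pickP => //= E; case/negP: P0.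
    suff <- : nth set0 (enum P) i = set0 by apply: hA.
    by apply/setP=> x; rewrite E inE.
  have hF i : i < 4 -> h i \in F.
    by move=> i4; rewrite -cP; apply/bigcupP; exists (nth set0 (enum P) i); auto.
  have hE i j : i < 4 -> j < 4 -> e (h i) (h j) = (i != j).
    move=> i4 j4; rewrite eE ?hF //.
    rewrite (def_pblock tP (hA _ i4) (hin _ i4)).
    rewrite (def_pblock tP (hA _ j4) (hin _ j4)).
    by rewrite nth_uniq ?enum_uniq // -cardE (leq_trans _ P4).
  exists (h 0), (h 1), (h 2), (h 3); split; rewrite ?hF //.
  by rewrite /is_K4 !hE.
pose R := [rel x y | ~~ e x y].
have eqR : {in F & &, equivalence_rel R}.
  move=> x y z xF yF zF; rewrite /R /= e_irr; split=> // xy; congr negb.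
  have yx : ~~ e y x by rewrite e_sym.
  by apply/idP/idP; apply: contraLR => H; [apply: (tr y)|apply: (tr x)].
pose P := equivalence_partition R F.
have /and3P[/eqP cP tP P0] := equivalence_partitionP eqR.
have pE : {in F &, forall x y, e x y = (pblock P x != pblock P y)}.
  move=> x y xF yF; rewrite eq_pblock ?cP //.
  by rewrite pblock_equivalence_partition //= negbK.
exists P; apply/andP; split.
  apply/andP; split; first exact: equivalence_partitionP.
  apply/forall_inP=> x xF; apply/forall_inP=> y yF; apply/eqP.
  rewrite pE //; apply/idP/exists_inP=> [neq|[A AP]].
    exists (pblock P x); first by rewrite pblock_mem ?cP.
    by apply/exists_inP; exists (pblock P y);
      rewrite ?pblock_mem ?cP // neq !mem_pblock cP xF yF.
  move=> /exists_inP[B BP /and3P[AB xA yB]].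
  by rewrite (def_pblock tP AP xA) (def_pblock tP BP yB).
pose t := [:: pblock P a; pblock P b; pblock P c; pblock P d].
have ut : uniq t.
  move: K; rewrite /is_K4 !pE //= !inE !negb_or.
  by case/and5P=> -> -> -> -> /andP[-> ->].
rewrite -[4]/(size t) -(card_uniqP ut); apply/subset_leq_card/subsetP=> A.
by rewrite !inE => /or4P[]/eqP->; rewrite pblock_mem ?cP.
Qed.

(** * Adding a vertex to a complete multipartite set *)

Section Extension.

Variable F : {set T}.
Hypotheses (no_K4 : no_K4_with_two_nbrs) (trF : nonadj_trans F).

(** The ends of an edge lie in different parts, and a vertex misses only its own part. *)
Lemma adj_edge_end x y z : x \in F -> y \in F -> z \in F ->
  e x y -> e z x || e z y.
Proof.
move=> xF yF zF; apply: contraLR; rewrite negb_or => /andP[zx zy].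
by apply: (trF zF xF yF _ zy); rewrite e_sym.
Qed.

Lemma adj_of_nonadj x y z : x \in F -> y \in F -> z \in F ->
  ~~ e z x -> e x y -> e z y.
Proof. by move=> xF yF zF /negbTE zx /(adj_edge_end xF yF zF); rewrite zx. Qed.

Variables k1 k2 k3 k4 : T.
Hypotheses (k1F : k1 \in F) (k2F : k2 \in F) (k3F : k3 \in F) (k4F : k4 \in F).
Hypothesis K4k : is_K4 k1 k2 k3 k4.

(** By [adj_edge_end], each of [x] and [y] misses at most one of the four [k_i], so two of these are
    adjacent to both. *)
Lemma edge_in_K4 x y : x \in F -> y \in F -> e x y ->
  exists c d, [/\ c \in F, d \in F & is_K4 x y c d].
Proof.
move=> xF yF xy; case/and5P: K4k => e12 e13 e14 e23 /andP[e24 e34].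
have H z : z \in F -> [&& e z k1 || e z k2, e z k1 || e z k3, e z k1 || e z k4,
    e z k2 || e z k3, e z k2 || e z k4 & e z k3 || e z k4].
  by move=> zF; rewrite !adj_edge_end.
have common p q : p \in F -> q \in F -> e p q ->
    [&& e x p, e x q, e y p & e y q] ->
    exists c d, [/\ c \in F, d \in F & is_K4 x y c d].
  move=> pF qF pq /and4P[xp xq yp yq].
  by exists p, q; rewrite /is_K4 xy xp xq yp yq pq.
move: (H x xF) (H y yF) (common _ _ k1F k2F e12) (common _ _ k1F k3F e13)
  (common _ _ k1F k4F e14) (common _ _ k2F k3F e23) (common _ _ k2F k4F e24)
  (common _ _ k3F k4F e34).
by case: (e x k1) (e x k2) (e x k3) (e x k4) (e y k1) (e y k2) (e y k3) (e y k4)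
  => [] [] [] [] [] [] [] []; auto.
Qed.

Ltac K4_tac := rewrite /is_K4; repeat (apply/andP; split);
  solve [assumption | rewrite e_sym; assumption].

Lemma nonnbrs_nonadj v a b x y :
  a \in F -> b \in F -> e a b -> e v a -> e v b -> x \in F -> y \in F ->
  ~~ e v x -> ~~ e v y -> ~~ e x y.
Proof.
move=> aF bF ab va vb xF yF vx vy; apply/negP => xy.
have [c [d [cF dF K]]] := edge_in_K4 xF yF xy.
(* If [a] and [b] were both adjacent to [x] and [y], then [v] would have exactly two neighbours in
   the [K_4] on [x, y, a, b]. Otherwise swapping [a] with [b] or [x] with [y] gives this case. *)
wlog ax : a b aF bF ab va vb x y xF yF vx vy xy K / ~~ e a x.
  move=> W.
  have yx : e y x by rewrite e_sym.
  have ba : e b a by rewrite e_sym.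
  have K' : is_K4 y x c d by case/and5P: K => ? ? ? ? /andP[? ?]; K4_tac.
  case ax: (e a x); last by apply: (W a b _ _ _ _ _ x y); rewrite ?ax.
  case ay: (e a y); last by apply: (W a b _ _ _ _ _ y x); rewrite ?ay.
  case bx: (e b x); last by apply: (W b a _ _ _ _ _ x y); rewrite ?bx.
  case by_: (e b y); last by apply: (W b a _ _ _ _ _ y x); rewrite ?by_.
  have Kxy : is_K4 x y a b by K4_tac.
  by have := no_K4 Kxy vx vy va; rewrite vb.
have ay : e a y by apply: (adj_of_nonadj (x := x)).
have bx : e b x.
  by rewrite e_sym; apply: (adj_of_nonadj (x := a)) => //; rewrite e_sym.
(* If [b] is adjacent to [y], it is also adjacent to [c] or [d], say [d]. Then [x, y, b, d] or
   [y, d, a, b] is the offending [K_4], according to whether [v] is adjacent to [d]. *)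
have [by_|nby] := boolP (e b y).
  wlog bd : c d cF dF K / e b d.
    move=> W; case/and5P: (K) => ? xc xd ? /andP[? cd].
    have K' : is_K4 x y d c by K4_tac.
    by case/orP: (adj_edge_end cF dF bF cd); [apply: (W d c)|apply: (W c d)].
  case/and5P: (K) => _ _ xd _ /andP[yd _].
  have ad : e a d by apply: (adj_of_nonadj (x := x)).
  have [vd|vd] := boolP (e v d).
    have K' : is_K4 x y b d by K4_tac.
    by have := no_K4 K' vx vy vb; rewrite vd.
  have K' : is_K4 y d a b by K4_tac.
  by have := no_K4 K' vy vd va; rewrite vb.
(* Now [a] shares the part of [x] and [b] that of [y], so both are adjacent to [c] and [d]. If [v]
   missed [c] and [d], then [c, d, a, b] would be the offending [K_4]. *)
wlog vc : c d cF dF K / e v c.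
  move=> W; case/and5P: (K) => _ xc xd yc /andP[yd cd].
  have [vc|vc] := boolP (e v c); first exact: (W c d).
  have [vd|vd] := boolP (e v d); first by apply: (W d c) => //; K4_tac.
  have ac : e a c by apply: (adj_of_nonadj (x := x)).
  have ad : e a d by apply: (adj_of_nonadj (x := x)).
  have bc : e b c by apply: (adj_of_nonadj (x := y)).
  have bd : e b d by apply: (adj_of_nonadj (x := y)).
  have K' : is_K4 c d a b by K4_tac.
  by have := no_K4 K' vc vd va; rewrite vb.
case/and5P: (K) => _ xc xd yc /andP[yd cd].
have [vd|vd] := boolP (e v d).
  by have := no_K4 K vx vy vc; rewrite vd.
have bc : e b c by apply: (adj_of_nonadj (x := y)).
have bd : e b d by apply: (adj_of_nonadj (x := y)).
have K' : is_K4 x d b c by K4_tac.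
by have := no_K4 K' vx vd vb; rewrite vc.
Qed.

Variables v a b : T.
Hypotheses (aF : a \in F) (bF : b \in F).
Hypotheses (ab : e a b) (va : e v a) (vb : e v b).

(** Otherwise take a triangle [y, z, c] in [F]. As [x] is in the part of [y], it is adjacent to [z]
    and [c], and by [nonnbrs_nonadj] so is [v]. Here [v] joins the [K_4] on [v, y, z, c], and [x] is
    the vertex with exactly two neighbours in it. *)
Lemma nonnbr_class x y : x \in F -> y \in F ->
  ~~ e v x -> ~~ e x y -> ~~ e v y.
Proof.
move=> xF yF vx xy; apply/negP => vy.
have [z zF yz] : exists2 z, z \in F & e y z.
  by case/and5P: K4k => /(adj_edge_end k1F k2F yF)/orP[] ? _ _ _ _;
    [exists k1|exists k2].
have [c [_ [cF _ /and5P[_ yc _ zc _]]]] := edge_in_K4 yF zF yz.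
have xz : e x z by apply: (adj_of_nonadj (x := y)).
have xc : e x c by apply: (adj_of_nonadj (x := y)).
have vz : e v z by apply: contraLR xz; apply: (nonnbrs_nonadj aF bF).
have vc : e v c by apply: contraLR xc; apply: (nonnbrs_nonadj aF bF).
have K : is_K4 v y z c by K4_tac.
by have := @no_K4 x _ _ _ _ K; rewrite e_sym xz xc => /(_ vx xy isT).
Qed.

(** With [v] in the middle this is [nonnbrs_nonadj]; with [v] at one end it is [nonnbr_class]. *)
Lemma nonadj_trans_setU1 : nonadj_trans (v |: F).
Proof.
move=> y x z; rewrite !inE => /predU1P[->|yF] /predU1P[->|xF] /predU1P[->|zF] //.
- by move=> xv vz; apply: (nonnbrs_nonadj aF bF ab va vb xF zF _ vz); rewrite e_sym.
- by move=> _ _; rewrite e_irr.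
- exact: nonnbr_class.
- by move=> xy yv; rewrite e_sym; apply: (nonnbr_class (x := y)); rewrite // e_sym.
- exact: trF.
Qed.

End Extension.
End Graph.

Theorem theorem2 (T : finType) (e : rel T)
    (e_sym : symmetric e) (e_irr : irreflexive e) :
  prison_free e <->
  (forall F : {set T}, maxset (complete_multipartite_ge e 4) F ->
   forall P : {set {set T}}, multipartite_parts e F P ->
   forall v : T, v \notin F ->
   #|[set A in P | neighbours e v :&: A != set0]| <= 1).
Proof.
apply: iff_trans (prison_freeP e_sym e_irr) _; split=> [nk F maxF P mP v vF|H v p q r s K vp vq vr].
  rewrite leqNgt; apply/negP => /card_gt1P[A [B []]].
  rewrite !inE => /andP[AP /set0Pn[a]] + /andP[BP /set0Pn[b]].
  rewrite !inE => /andP[va aA] /andP[vb bB] AB.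
  have eE := multipartite_partsE mP; case/andP: mP => /and3P[/eqP cP tP _] _.
  have aF : a \in F by rewrite -cP; apply/bigcupP; exists A.
  have bF : b \in F by rewrite -cP; apply/bigcupP; exists B.
  have ab : e a b by rewrite eE // (def_pblock tP AP aA) (def_pblock tP BP bB).
  case/maxsetP: maxF => /complete_multipartite_ge4P[] // trF.
  move=> [k1 [k2 [k3 [k4 [k1F k2F k3F k4F K]]]]] maxF.
  (* The larger set [v |: F] keeps the [K_4] of [F], so maximality forces [v] into [F]. *)
  case/negP: vF; rewrite -(maxF (v |: F)) ?setU11 ?subsetUr //.
  apply/complete_multipartite_ge4P => //; split.
    exact: (nonadj_trans_setU1 e_sym e_irr nk trF k1F k2F k3F k4F K aF bF ab va vb).
  by exists k1, k2, k3, k4; rewrite !inE k1F k2F k3F k4F !orbT.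
apply/negP=> vs; case/and5P: (K) => pq pr ps qr /andP[qs rs].
pose S := [set p; q; r; s].
have SK : complete_multipartite_ge e 4 S.
  apply/complete_multipartite_ge4P => //; split; last first.
    by exists p, q, r, s; rewrite !inE !eqxx !orbT.
  (* On a clique non-adjacency is equality, hence transitive. *)
  have eS : {in S &, forall x y, e x y = (x != y)}.
    move=> x y; rewrite !inE -!orbA => Hx Hy.
    have [->|] := eqVneq x y; first by rewrite e_irr.
    by case/or4P: Hx Hy => /eqP-> /or4P[]/eqP->; rewrite ?eqxx // e_sym.
  by move=> y x z yS xS zS; rewrite !eS // !negbK => /eqP-> /eqP->.
have [F maxF SF] := maxset_exists SK.
have pF : p \in F by apply: (subsetP SF); rewrite !inE eqxx ?orbT.
have qF : q \in F by apply: (subsetP SF); rewrite !inE eqxx ?orbT.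
have rF : r \in F by apply: (subsetP SF); rewrite !inE eqxx ?orbT.
have sF : s \in F by apply: (subsetP SF); rewrite !inE eqxx ?orbT.
have cF := maxsetp maxF; case/complete_multipartite_ge4P: (cF) => // trF _.
(* Inside [F], missing both [p] and [q] would make these two non-adjacent. *)
have [vF|vF] := boolP (v \in F).
  by have := trF v p q vF pF qF; rewrite e_sym pq => /(_ vp vq).
case/existsP: cF => P /andP[mP _]; have := H F maxF P mP v vF.
rewrite leqNgt => /negP[]; apply/card_gt1P; exists (pblock P r), (pblock P s).
have -> : pblock P r != pblock P s by rewrite -(multipartite_partsE mP).
case/andP: mP => /and3P[/eqP cP _ _] _; rewrite !inE !pblock_mem ?cP //=.
by split=> //; apply/set0Pn; [exists r|exists s]; rewrite !inE mem_pblock cP ?vr ?vs.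
Qed.
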